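(* Let $C$ be a real constant. Let $A=(a_{ij})$ be an $n\times n$ (column) stochastic matrix, and suppose $\operatorname{per}(A)\ge n^{-C}$. Then all but $O_C(\log n)$ of the rows of $A$ contain an entry that is at least $0.8$, with the remaining entries in that row summing to at most $0.1$.
   Context: A column stochastic matrix is a real matrix with nonnegative entries in which each column sums to $1$. The permanent is $\operatorname{per}(A)=\sum_{\sigma\in S_n}\prod_{i=1}^n a_{i\sigma(i)}$. $O_C(\log n)$ denotes a quantity bounded by $K\log n$ with $K$ depending only on $C$. *)

(* Defs.v *)
From HB Require Import structures.
From mathcomp Require Import all_boot all_order all_algebra all_fingroup.
From mathcomp Require Import reals exp.

Set Implicit Arguments.
Unset Strict Implicit.
Unset Printing Implicit Defensive.

Import Order.TTheory GRing.Theory Num.Theory.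
Local Open Scope ring_scope.

Definition permanent (R : pzSemiRingType) (n : nat) (A : 'M[R]_n) : R :=
  \sum_(s : 'S_n) \prod_(i < n) A i (s i).

Definition column_stochastic (R : numDomainType) (m n : nat)
    (A : 'M[R]_(m, n)) : Prop :=
  (forall i j, 0 <= A i j) /\ (forall j, \sum_(i < m) A i j = 1).

Definition dominated_row (R : numFieldType) (m n : nat)
    (A : 'M[R]_(m, n)) (i : 'I_m) : bool :=
  [exists j : 'I_n,
    (8%:R / 10%:R <= A i j) && (\sum_(k < n | k != j) A i k <= 1 / 10%:R)].

(* Main.v *)
Require Import Defs.
From HB Require Import structures.
From mathcomp Require Import all_boot all_order all_algebra all_fingroup.
From mathcomp Require Import reals exp.
From mathcomp Require Import sequences ring lra.

Set Implicit Arguments.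
Unset Strict Implicit.
Unset Printing Implicit Defensive.

Import Order.TTheory GRing.Theory Num.Theory.
Local Open Scope ring_scope.

(** Send every column [j] independently to a random row, row [i] being chosen
    with probability [A i j]. Then [permanent A] is the probability that the
    resulting map is a bijection, hence at most the probability that every row
    is hit. The events that given rows are hit are negatively correlated,
    because a column serves only one row; so (lemma [permanent_le_prod_hit])
    the permanent is at most the product over the rows of
    [p i = 1 - \prod_j (1 - A i j)], the probability that row [i] is hit.

    A row that is not dominated lowers this product by a constant factor, for
    one of two reasons. Let [r i] be the sum of row [i].
    - If [r i <= 21/20], then no entry of the row exceeds [19/20], since
      otherwise the others would sum to at most [1/10] and the row would be
      dominated. The row is then missed with probability at least
      [exp(-21)] (lemma [hit_mass_le_expR]), so [p i <= 1 - exp(-21)].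
    - If [r i > 21/20], one uses that the row sums add up to [n], so that
      [\prod_i p i = \prod_i (p i * exp(1 - r i))]. By the union bound
      [p i <= r i <= exp(r i - 1)], so no factor on the right exceeds [1],
      and those of the rows in question are at most [exp(-1/20)].

    A product that is at least [n^-C], with factors in [[0, 1]], has at most
    [C * ln n / - ln q] factors that are at most [q < 1]. Applied to both
    products, this bounds the number of rows of each kind. *)

(** If each [a j] is a probability distribution on [I], this is the probability
    that independent draws from [a 0, ..., a (m-1)] together cover [B]. *)
Definition cover_mass (R : pzSemiRingType) (I : finType) (m : nat)
    (a : 'I_m -> I -> R) (B : {set I}) : R :=
  \sum_(t : m.-tuple I | B \subset t) \prod_(j < m) a j (tnth t j).

(** The probability that at least one of these independent draws equals [i]. *)
Definition hit_mass (R : pzRingType) (I : finType) (m : nat)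
    (a : 'I_m -> I -> R) (i : I) : R :=
  1 - \prod_(j < m) (1 - a j i).

(** Only the terms of degree at most one in [c] are kept in the expansion of the
    product on the right. *)
Lemma prodrD_ge_linear (R : numDomainType) (I : finType) (B : {set I})
    (p c : I -> R) :
  (forall i, 0 <= p i) -> (forall i, 0 <= c i) ->
  \prod_(i in B) p i + \sum_(k in B) c k * \prod_(i in B :\ k) p i
    <= \prod_(i in B) (p i + c i).
Proof.
move=> p0 c0; have [n] := ubnP #|B|; elim: n B => // n IH B.
have [->|[x xB]] := set_0Vmem B; first by rewrite !big_set0 addr0.
rewrite (cardsD1 x) xB ltnS => /IH {}IH.
have sumE : \sum_(k in B :\ x) c k * \prod_(i in B :\ k) p i =
    p x * \sum_(k in B :\ x) c k * \prod_(i in B :\ x :\ k) p i.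
  rewrite mulr_sumr; apply: eq_bigr => k; rewrite !inE => /andP[kx _].
  have xBk : x \in B :\ k by rewrite !inE eq_sym kx.
  by rewrite (big_setD1 x xBk) /= !setDDl setUC mulrCA.
rewrite !(big_setD1 x xB) /= sumE mulrDl.
have le_pc : \prod_(i in B :\ x) p i <= \prod_(i in B :\ x) (p i + c i).
  by apply: ler_prod => i _; rewrite p0 lerDl c0.
apply: le_trans (lerD (ler_wpM2l (p0 x) IH) (ler_wpM2l (c0 x) le_pc)).
by rewrite mulrDr addrAC addrA.
Qed.

(** If the first draw gives [k], the others have to cover what remains of [B]
    without [k]. *)
Lemma cover_mass_recl (R : comPzRingType) (I : finType) (m : nat)
    (a : 'I_m.+1 -> I -> R) (B : {set I}) :
  cover_mass a B =
  \sum_k a ord0 k * cover_mass (fun j => a (lift ord0 j)) (B :\ k).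
Proof.
rewrite /cover_mass.
under [RHS]eq_bigr do rewrite mulr_sumr.
rewrite pair_big_dep /=.
rewrite (reindex (fun q : I * m.-tuple I => [tuple of q.1 :: q.2])) /=; last first.
  exists (fun t : m.+1.-tuple I => (thead t, [tuple of behead t])).
    by move=> [x t] _ /=; rewrite theadE; congr pair; apply: val_inj.
  by move=> t _ /=; rewrite [RHS]tuple_eta.
apply: eq_big => [[x t]|[x t] _] /=.
  apply/subsetP/subsetP => sB i.
    by rewrite !inE => /andP[/negPf ix /sB]; rewrite inE ix.
  by move=> iB; rewrite inE; case: eqVneq => //= ix; apply: sB; rewrite !inE ix.
rewrite big_ord_recl; congr (_ * _).
by apply: eq_bigr => j _; rewrite tnthS.
Qed.

Lemma hit_mass_ge0_le1 (R : numDomainType) (I : finType) (m : nat)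
    (a : 'I_m -> I -> R) (i : I) :
  (forall j, 0 <= a j i <= 1) -> 0 <= hit_mass a i <= 1.
Proof.
move=> a01; rewrite /hit_mass subr_ge0 gerBl.
by rewrite prodr_ile1 ?prodr_ge0 // => j _; have /andP[? ?] := a01 j;
  rewrite ?subr_ge0 ?gerBl //; apply/andP.
Qed.

Lemma hit_mass_recl (R : comPzRingType) (I : finType) (m : nat)
    (a : 'I_m.+1 -> I -> R) (i : I) :
  let p := hit_mass (fun j => a (lift ord0 j)) i in
  hit_mass a i = p + a ord0 i * (1 - p).
Proof. by rewrite /hit_mass big_ord_recl /=; ring. Qed.

(** Negative correlation, by induction on the number of draws. Write [h i] for
    the probability that [i] is hit by a draw other than the first. By
    [cover_mass_recl] and the induction hypothesis the left-hand side is at most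
    the average of [\prod_(i in B :\ k) h i] over the value [k] of the first
    draw, which equals
    [\prod_B h + \sum_(k in B) a 0 k * (1 - h k) * \prod_(B :\ k) h].
    These are the terms of degree at most one of the right-hand side, whose
    factors are [h i + a 0 i * (1 - h i)]. *)
Lemma cover_mass_le (R : numDomainType) (I : finType) (m : nat)
    (a : 'I_m -> I -> R) (B : {set I}) :
  (forall j i, 0 <= a j i) -> (forall j, \sum_i a j i = 1) ->
  cover_mass a B <= \prod_(i in B) hit_mass a i.
Proof.
elim: m a B => [|m IH] a B a0 a1.
  rewrite /cover_mass; have [->|[x xB]] := set_0Vmem B.
    rewrite big_set0 (big_pred1 [tuple]) ?big_ord0 // => t.
    have -> : (set0 : {set I}) \subset t by apply/subsetP => i; rewrite inE.
    by rewrite /= [t]tuple0; apply/esym/eqP.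
  rewrite [leLHS]big_pred0 => [|t].
    by apply: prodr_ge0 => i _; rewrite /hit_mass big_ord0 subrr.
  by apply/negbTE/subsetPn; exists x => //; rewrite [t]tuple0.
have ale1 j i : a j i <= 1.
  by rewrite -(a1 j) (bigD1 i) //= lerDl sumr_ge0.
set b := fun j => a (lift ord0 j).
have h01 i : 0 <= hit_mass b i <= 1.
  by apply: hit_mass_ge0_le1 => j; rewrite a0 ale1.
have h0 i : 0 <= hit_mass b i by case/andP: (h01 i).
rewrite cover_mass_recl -/b.
under [leRHS]eq_bigr do rewrite hit_mass_recl -/b.
apply: le_trans (prodrD_ge_linear B h0 _); last first.
  by move=> i; rewrite mulr_ge0 // subr_ge0; case/andP: (h01 i).
apply: (@le_trans _ _ (\sum_k a ord0 k * \prod_(i in B :\ k) hit_mass b i)).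
  by apply: ler_sum => k _; rewrite ler_wpM2l // IH // => j; rewrite /b.
have -> : \prod_(i in B) hit_mass b i
    = \sum_k a ord0 k * \prod_(i in B) hit_mass b i.
  by rewrite -mulr_suml a1 mul1r.
(* Compare the coefficients of a 0 k: for k outside B, B :\ k is B. *)
rewrite [X in _ + X]big_mkcond.
rewrite -big_split /= le_eqVlt; apply/orP; left; apply/eqP.
apply: eq_bigr => k _; case: ifPn => kB.
  by rewrite (big_setD1 k kB) /=; ring.
rewrite addr0; congr (_ * _); apply: eq_bigl => i; rewrite !inE.
by case: eqVneq => // ->; rewrite (negPf kB).
Qed.

(** Permutations are among the maps whose image is everything. *)
Lemma permanent_le_cover_mass (R : numDomainType) (n : nat) (A : 'M[R]_n) :
  (forall i j, 0 <= A i j) ->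
  permanent A <= cover_mass (fun j i => A i j) setT.
Proof.
move=> A0; rewrite /permanent (reindex_inj invg_inj) /=.
pose h (s : 'S_n) := [tuple s j | j < n].
have hinj : injective h.
  move=> s t /(congr1 (fun u => tnth u)) e; apply/permP => j.
  by have := congr1 (@^~ j) e; rewrite /= !tnth_mktuple.
rewrite (eq_bigr (fun s => \prod_(j < n) A (tnth (h s) j) j)); last first.
  move=> s _; rewrite (reindex_inj (@perm_inj _ s)) /=.
  by apply: eq_bigr => j _; rewrite permK tnth_mktuple.
rewrite -(big_imset (fun t : n.-tuple 'I_n => \prod_(j < n) A (tnth t j) j)
  (h := h) (A := predT)) /=; last by move=> s t _ _; apply: hinj.
rewrite /cover_mass big_mkcond [leRHS]big_mkcond /=; apply: ler_sum => t _.
have F0 : 0 <= \prod_(j < n) A (tnth t j) j by rewrite prodr_ge0.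
case: imsetP => [[s _ ->]|_]; last by case: ifP.
rewrite ifT //; apply/subsetP => i _.
by apply/tnthP; exists (s^-1%g i); rewrite tnth_mktuple permKV.
Qed.

Lemma permanent_le_prod_hit (R : numDomainType) (n : nat) (A : 'M[R]_n) :
  column_stochastic A ->
  permanent A <= \prod_(i < n) hit_mass (fun j i => A i j) i.
Proof.
move=> [A0 A1]; apply: le_trans (permanent_le_cover_mass A0) _.
rewrite [leRHS](eq_bigl (fun i => i \in [set: 'I_n])) => [|i]; last first.
  by rewrite inE.
exact: cover_mass_le.
Qed.

(** The union bound. *)
Lemma hit_mass_le_sum (R : numDomainType) (I : finType) (m : nat)
    (a : 'I_m -> I -> R) (i : I) :
  (forall j, 0 <= a j i <= 1) -> hit_mass a i <= \sum_(j < m) a j i.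
Proof.
elim: m a => [|m IH] a a01; first by rewrite /hit_mass !big_ord0 subrr.
rewrite hit_mass_recl big_ord_recl addrC.
set p := hit_mass _ _.
have /andP[p0 p1] : 0 <= p <= 1 by apply: hit_mass_ge0_le1.
have /andP[a0 _] := a01 ord0.
by rewrite lerD ?IH // ler_piMr // gerBl.
Qed.

(** On [[0, 19/20]] one has [1 - x >= exp(-20 x)], since
    [1 / (1 - x) = 1 + x / (1 - x) <= 1 + 20 x]; hence the probability of a miss
    is at least [exp(-20 * 21/20)]. *)
Lemma hit_mass_le_expR (R : realType) (I : finType) (m : nat)
    (a : 'I_m -> I -> R) (i : I) :
  (forall j, 0 <= a j i <= 19%:R / 20%:R) ->
  \sum_(j < m) a j i <= 21%:R / 20%:R ->
  hit_mass a i <= 1 - expR (- 21%:R).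
Proof.
move=> a01 ar; rewrite /hit_mass lerD2l lerN2.
apply: (@le_trans _ _ (\prod_(j < m) expR (- (20%:R * a j i)))).
  rewrite -expR_sum ler_expR sumrN -mulr_sumr; lra.
apply: ler_prod => j _; rewrite expR_ge0 /=.
have /andP[a0 a1] := a01 j.
have e1 := expR_ge1Dx (20%:R * a j i).
rewrite expRN -[leLHS]mul1r ler_pdivrMr ?expR_gt0 //.
by apply: le_trans (ler_wpM2l _ e1); nra.
Qed.

Lemma prodr_le_expr_card (R : numDomainType) (I : finType) (B : {set I})
    (f : I -> R) (q : R) :
  (forall i, 0 <= f i <= 1) -> (forall i, i \in B -> f i <= q) ->
  \prod_i f i <= q ^+ #|B|.
Proof.
move=> f01 fq; rewrite -prodr_const [leRHS]big_mkcond.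
apply: ler_prod => i _; have /andP[-> f1] := f01 i.
by case: ifP => // /fq.
Qed.

Theorem theoremA1 (R : realType) (C : R) :
  exists K : R, forall (n : nat) (A : 'M[R]_n),
    (0 < n)%N ->
    column_stochastic A ->
    n%:R `^ (- C) <= permanent A ->
    #|[set i : 'I_n | ~~ dominated_row A i]|%:R <= K * ln (n%:R : R).
Proof.
pose q : R := 1 - expR (- 21%:R).
have q0 : 0 < q by rewrite subr_gt0 expR_lt1; lra.
have q1 : q < 1 by rewrite gtrBl expR_gt0.
have lq : 0 < - ln q by rewrite oppr_gt0 ln_lt0 // q0.
exists (C / - ln q + 20%:R * C) => n A n0 cA perA.
have [A0 A1] := cA.
have n0' : 0 < n%:R :> R by rewrite ltr0n.
have ale1 i j : A i j <= 1 by rewrite -(A1 j) (bigD1 i) //= lerDl sumr_ge0.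
pose r i := \sum_(j < n) A i j.
pose p i := hit_mass (fun j i => A i j) i.
have p01 i : 0 <= p i <= 1 by apply: hit_mass_ge0_le1 => j; rewrite A0 ale1.
have pr i : p i <= r i by apply: hit_mass_le_sum => j; rewrite A0 ale1.
have {}perA : expR (- (C * ln n%:R)) <= \prod_i p i.
  apply: le_trans (permanent_le_prod_hit cA); apply: le_trans perA.
  by rewrite /powR gt_eqF // mulNr.
set B := [set i | _].
(* Rows in B outside H have small entries; those in H are too heavy. *)
pose H := [set i | 21%:R / 20%:R < r i].
have hL : #|B :\: H|%:R * (- ln q) <= C * ln n%:R.
  have : expR (- (C * ln n%:R)) <= q ^+ #|B :\: H|.
    apply: le_trans perA _; apply: prodr_le_expr_card => // i.
    rewrite !inE -leNgt => /andP[ri nd].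
    apply: hit_mass_le_expR => // j; rewrite A0 /=.
    rewrite leNgt; apply: contra nd => Aij; apply/existsP; exists j.
    move: ri; rewrite /r (bigD1 j) //= => ri.
    by apply/andP; split; lra.
  rewrite -{1}(lnK q0) -expRM_natl ler_expR; lra.
have hH : #|H|%:R * (1 / 20%:R) <= C * ln n%:R.
  have : expR (- (C * ln n%:R)) <= expR (- (1 / 20%:R)) ^+ #|H|.
    apply: le_trans perA _.
    (* The added exponents 1 - r i sum to 0. *)
    have -> : \prod_i p i = \prod_i (p i * expR (1 - r i)).
      have rn : \sum_i r i = \sum_(i < n) 1.
        by rewrite /r exchange_big; apply: eq_bigr => j _.
      by rewrite big_split /= -expR_sum sumrB rn subrr expR0 mulr1.
    apply: prodr_le_expr_card => i.
      have /andP[pi0 pi1] := p01 i.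
      rewrite mulr_ge0 ?expR_ge0 //=.
      have e := expR_ge1Dx (r i - 1).
      rewrite -opprB expRN ler_pdivrMr ?expR_gt0 // mul1r.
      by apply: le_trans (pr i) _; lra.
    rewrite inE => ri; have /andP[pi0 pi1] := p01 i.
    apply: le_trans (ler_wpM2r (expR_ge0 _) pi1) _.
    rewrite [leLHS]mul1r ler_expR; lra.
  rewrite -expRM_natl ler_expR; lra.
have cB : #|B|%:R <= #|B :\: H|%:R + #|H|%:R :> R.
  rewrite -natrD ler_nat -(cardsID H B) addnC leq_add2l.
  by rewrite subset_leq_card ?subsetIr.
apply: le_trans cB _; rewrite mulrDl lerD //; last by lra.
by rewrite mulrAC ler_pdivlMr.
Qed.
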